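(* Let $\mu$ be a positive, finite, continuous (i.e. atomless) Borel measure on $\mathbb{R}^n$ and $\nu$ a positive, finite, continuous Borel measure on $\mathbb{R}^m$, and assume that each of $L^2(\mu)$ and $L^2(\nu)$ admits a Fourier frame. Define the measure $\rho=\mu\times\delta_0+\delta_0\times\nu$ on $\mathbb{R}^{n+m}=\mathbb{R}^n\times\mathbb{R}^m$, i.e. $$\int_{\mathbb{R}^n\times\mathbb{R}^m} f(x,y)\,d\rho(x,y)=\int_{\mathbb{R}^n} f(x,0)\,d\mu(x)+\int_{\mathbb{R}^m} f(0,y)\,d\nu(y)$$ for every continuous compactly supported $f$. Then $L^2(\rho)$ admits a Fourier frame.
   Context: For $\lambda\in\mathbb{R}^d$ let $e_\lambda(x)=e^{2\pi i\langle\lambda,x\rangle}$. For a positive finite Borel measure $\mu$ on $\mathbb{R}^d$ and a countable set $\Lambda\subset\mathbb{R}^d$, the system $E(\Lambda)=\{e_\lambda\}_{\lambda\in\Lambda}$ is a Fourier frame for $L^2(\mu)$ if there are constants $0<A,B<\infty$ with $A\|f\|^2_{L^2(\mu)}\le\sum_{\lambda\in\Lambda}|\langle f,e_\lambda\rangle_{L^2(\mu)}|^2\le B\|f\|^2_{L^2(\mu)}$ for all $f\in L^2(\mu)$. ''$L^2(\mu)$ admits a Fourier frame'' means such a $\Lambda$ exists. $\delta_0$ denotes the Dirac measure at the origin. *)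

(* Defs.v *)
From HB Require Import structures.
From mathcomp Require Import all_boot all_order all_algebra.
From mathcomp Require Import all_classical all_reals all_analysis.
Set Implicit Arguments. Unset Strict Implicit. Unset Printing Implicit Defensive.
Import Order.TTheory GRing.Theory Num.Theory.
Import numFieldNormedType.Exports.
Local Open Scope classical_set_scope.
Local Open Scope ring_scope.

Definition Rd (R : realType) (d : nat) :=
  g_sigma_algebraType (@open ('rV[R]_d)).

Definition dotv (R : realType) (d : nat) (l x : 'rV[R]_d) : R :=
  \sum_(i < d) l ord0 i * x ord0 i.

Definition atomless (R : realType) (d : nat)
  (mu : set (Rd R d) -> \bar R) : Prop :=
  forall x : Rd R d, mu [set x] = 0%E.

(** A complex-valued function f = u + i v on R^d (u, v real-valued) belongs
    to L^2(mu): u, v Borel measurable and |f|^2 = u^2 + v^2 mu-integrable. *)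
Definition L2fun (R : realType) (d : nat) (mu : {measure set (Rd R d) -> \bar R})
  (u v : Rd R d -> R) : Prop :=
  [/\ measurable_fun setT u, measurable_fun setT v &
      mu.-integrable setT (fun x => ((u x) ^+ 2 + (v x) ^+ 2)%:E)].

Definition L2norm2 (R : realType) (d : nat) (mu : {measure set (Rd R d) -> \bar R})
  (u v : Rd R d -> R) : \bar R :=
  (\int[mu]_x ((u x) ^+ 2 + (v x) ^+ 2)%:E)%E.

(** |<f, e_l>_{L^2(mu)}|^2 for f = u + i v, where e_l(x) = exp(2 pi i <l,x>):
    <f, e_l> = \int f(x) conj(e_l(x)) dmu(x), whose real part is
    \int (u cos t + v sin t) and imaginary part \int (v cos t - u sin t),
    with t = 2 pi <l, x>. *)
Definition fourier_coef2 (R : realType) (d : nat)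
  (mu : {measure set (Rd R d) -> \bar R}) (u v : Rd R d -> R) (l : 'rV[R]_d) : R :=
  let t := fun x : Rd R d => 2 * pi * dotv l x in
  (Rintegral mu setT (fun x => u x * cos (t x) + v x * sin (t x))) ^+ 2
  + (Rintegral mu setT (fun x => v x * cos (t x) - u x * sin (t x))) ^+ 2.

Definition fourier_frame (R : realType) (d : nat)
  (mu : {measure set (Rd R d) -> \bar R}) (Lam : set 'rV[R]_d) : Prop :=
  countable Lam /\
  exists A B : R, [/\ 0 < A, 0 < B &
    forall u v : Rd R d -> R, L2fun mu u v ->
      ((A%:E * L2norm2 mu u v
          <= \esum_(l in Lam) (fourier_coef2 mu u v l)%:E)
       /\ (\esum_(l in Lam) (fourier_coef2 mu u v l)%:E
          <= B%:E * L2norm2 mu u v))%E].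

Definition admits_fourier_frame (R : realType) (d : nat)
  (mu : {measure set (Rd R d) -> \bar R}) : Prop :=
  exists Lam : set 'rV[R]_d, fourier_frame mu Lam.

(* Main.v *)
Require Import Defs.
From HB Require Import structures.
From mathcomp Require Import all_boot all_order all_algebra.
From mathcomp Require Import all_classical all_reals all_analysis.
From mathcomp Require Import measurable_realfun ring lra.
Import Order.TTheory GRing.Theory Num.Theory.
Import numFieldNormedType.Exports.
Local Open Scope classical_set_scope.
Local Open Scope ring_scope.

(** L^2(rho) is the orthogonal sum of L^2(mu) and L^2(nu), and the coefficient of
    f + g at (l, s) is <f, e_l> + <g, e_s>.  If mu and nu are nonzero and
    atomless, their frames L and M are infinite: a set E of small positive
    measure violates the lower bound of a finite frame.  Repeat every l in L
    N times and pair the copies with distinct elements of M.  Since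
    |a + b|^2 >= |a|^2 / 2 - |b|^2, these pairs give a sum of squares at least
    N A |f|^2 / 2 - B' |g|^2, where the Bessel bound B' of M does not depend
    on N.  Exchanging the roles of L and M and taking N large, the union of the
    two families of pairs is a frame. *)

(** * Nonnegative sums and the pairing of index sets *)

Lemma subset_esum (R : realType) (T : choiceType) (A B : set T) (f : T -> \bar R) :
  (forall x, 0 <= f x)%E -> A `<=` B ->
  (\esum_(i in A) f i <= \esum_(i in B) f i)%E.
Proof.
move=> f0 AB; rewrite (esumID A B)//= (setIidr AB).
by rewrite leeDl// esum_ge0.
Qed.

Lemma esum_setU_le (R : realType) (T : choiceType) (A B : set T)
    (f : T -> \bar R) : (forall x, 0 <= f x)%E ->
  (\esum_(i in A `|` B) f i <= \esum_(i in A) f i + \esum_(i in B) f i)%E.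
Proof.
move=> f0; rewrite (esumID A)//=; apply: leeD; apply: subset_esum => //.
by move=> x [[]].
Qed.

Lemma esum_ord_cst (R : realType) (N : nat) (c : \bar R) : (0 <= c)%E ->
  \esum_(j in [set: 'I_N]) c = (N%:R%:E * c)%E.
Proof.
move=> c0; have -> : [set: 'I_N] = [set` enum 'I_N].
  by apply/seteqP; split=> i //= _; rewrite mem_enum.
rewrite esum_fset// -fsbig_seq ?enum_uniq// big_enum/=.
by rewrite big_const card_ord iter_addr_0 mule_natl.
Qed.

(** The set [S] lies [N]-to-one over [A] and one-to-one over part of [B]. An injection [g] of [A]
    into the naturals and a sequence [e] of distinct elements of [B] suffice: the copy of [x]
    numbered [j] is paired with the term of [e] of index [g x * N + j]. The conclusions are phrased
    by sums because the frame bounds use [S] only through them. *)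
Lemma exists_pairing (T1 : choiceType) (T2 : pointedType) (A : set T1) (B : set T2)
    (N : nat) : countable A -> infinite_set B ->
  exists S : set (T1 * T2), [/\ countable S,
    forall (R : realType) (a : T1 -> \bar R), (forall x, 0 <= a x)%E ->
      \esum_(p in S) a p.1 = (N%:R%:E * \esum_(x in A) a x)%E &
    forall (R : realType) (b : T2 -> \bar R), (forall y, 0 <= b y)%E ->
      (\esum_(p in S) b p.2 <= \esum_(y in B) b y)%E].
Proof.
move=> /countable_injP[g ginj] /infiniteP/pcard_leP[e].
pose D := [set: 'I_N] `*`` (fun=> A).
pose phi (k : 'I_N * T1) : T2 := e (g k.2 * N + k.1)%N.
have phiinj : set_inj D phi.
  move=> [j x] [j' x']; rewrite !inE => -[_ /= Ax] [_ /= Ax'].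
  rewrite /phi/= => /(@inj _ _ _ e).
  rewrite !inE => /(_ I I) E.
  (* Euclidean division by [N] recovers [g x] as the quotient, and then [j]. The existence of [j] in
     ['I_N] makes [N] positive. *)
  have N0 : (0 < N)%N by rewrite (leq_ltn_trans _ (ltn_ord j)).
  have /ginj : g x = g x'.
    by have := congr1 (divn^~ N) E; rewrite !divnMDl// !divn_small// !addn0.
  rewrite !inE => /(_ Ax Ax') xx'; rewrite xx' in E *.
  by move/addnI : E => /val_inj ->.
pose h (k : 'I_N * T1) := (k.2, phi k).
have hinj : set_inj D h by move=> k k' Dk Dk' [_]; exact: phiinj.
exists (h @` D); split.
- apply: (sub_countable (card_image_le _ _)); apply/countable_injP.
  exists (fun k : 'I_N * T1 => g k.2 * N + k.1)%N => k k' Dk Dk' E.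
  by apply: phiinj => //; rewrite /phi E.
- move=> R a a0; rewrite esum_image//= -(@esum_esum _ _ _ setT (fun=> A) (fun=> a))//.
  by rewrite esum_ord_cst// esum_ge0.
- move=> R b b0; rewrite esum_image//= -(esum_image D phi)//.
  by apply: subset_esum => // _ [k _ <-]; exact: funS.
Qed.

(** * Measurability of the axis embeddings and of the trigonometric factors *)

Lemma continuous_mx (R : realType) (T : topologicalType) (m n : nat)
    (f : T -> 'M[R]_(m, n)) :
  (forall i j, continuous (fun x => f x i j)) -> continuous f.
Proof.
move=> cf x A [P Pfx PA].
(* [P] assigns to every entry a neighbourhood, and their product lies in [A]; there are finitely
   many entries, so the preimages can be intersected. *)
have /filterS : [set y | forall i j, P i j (f y i j)] `<=` f @^-1` A.
  by move=> y Py; exact: PA.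
apply; apply: filter_forall => i; apply: filter_forall => j.
exact: cf (Pfx i j).
Qed.

Lemma continuous_row_mx (R : realType) (T : topologicalType) (n m : nat)
    (f : T -> 'rV[R]_n) (g : T -> 'rV[R]_m) :
  continuous f -> continuous g ->
  continuous (fun x => row_mx (f x) (g x) : 'rV[R]_(n + m)).
Proof.
move=> cf cg; apply: continuous_mx => i j.
under eq_fun do rewrite mxE.
case: (fintype.split j) => k x.
  exact: (@continuous_comp _ _ _ f (fun M => M i k) x (cf x)
    (@coord_continuous _ _ _ i k (f x))).
exact: (@continuous_comp _ _ _ g (fun M => M i k) x (cg x)
  (@coord_continuous _ _ _ i k (g x))).
Qed.

Lemma continuous_Rd_measurable (R : realType) (n m : nat)
    (f : 'rV[R]_n -> 'rV[R]_m) : continuous f ->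
  measurable_fun setT (f : Rd R n -> Rd R m).
Proof.
move=> /continuousP cf.
apply: (@measurability _ _ (Rd R n) (Rd R m) setT f (@open 'rV[R]_m)).
  by [].
move=> _ [B oB <-].
by rewrite setTI; apply: sub_sigma_algebra; exact: cf.
Qed.

Lemma continuous_real_measurable (R : realType) (n : nat)
    (f : 'rV[R]_n -> R) : continuous f ->
  measurable_fun setT (f : Rd R n -> R).
Proof.
move=> /continuousP cf.
apply: (measurability _ (measurable_realfun.RGenOpens.measurableE R)).
move=> _ [_ [a [b ->] <-]].
by rewrite setTI; apply: sub_sigma_algebra; exact/cf/interval_open.
Qed.

Lemma measurable_row_mx0r (R : realType) (n m : nat) :
  measurable_fun setT (fun x : Rd R n => row_mx x 0 : Rd R (n + m)).
Proof.
apply: continuous_Rd_measurable; apply: continuous_row_mx.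
  by move=> x.
by exact: cst_continuous.
Qed.

Lemma measurable_row_mx0l (R : realType) (n m : nat) :
  measurable_fun setT (fun y : Rd R m => row_mx 0 y : Rd R (n + m)).
Proof.
apply: continuous_Rd_measurable; apply: continuous_row_mx.
  by exact: cst_continuous.
by move=> x.
Qed.

Lemma measurable_dotv (R : realType) (n : nat) (l : 'rV[R]_n) :
  measurable_fun setT (dotv l : Rd R n -> R).
Proof.
apply: measurable_sum => i; apply: measurable_funM => //.
apply: (@continuous_real_measurable _ _ (fun x => x ord0 i)).
exact: coord_continuous.
Qed.

Lemma measurable_cos_dotv (R : realType) (n : nat) (l : 'rV[R]_n) :
  measurable_fun setT (fun x : Rd R n => cos (2 * pi * dotv l x)).
Proof.
apply: (measurableT_comp (continuous_measurable_fun (@continuous_cos R))).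
by apply: measurable_funM => //; exact: measurable_dotv.
Qed.

Lemma measurable_sin_dotv (R : realType) (n : nat) (l : 'rV[R]_n) :
  measurable_fun setT (fun x : Rd R n => sin (2 * pi * dotv l x)).
Proof.
apply: (measurableT_comp (continuous_measurable_fun (@continuous_sin R))).
by apply: measurable_funM => //; exact: measurable_dotv.
Qed.

(** * Integration against a sum of two pushforward measures *)

Lemma integral_pushforward_add (R : realType) (d1 d2 d : measure_display)
    (X : measurableType d1) (Y : measurableType d2) (Z : measurableType d)
    (mu : {measure set X -> \bar R}) (nu : {measure set Y -> \bar R})
    (rho : {measure set Z -> \bar R}) (phi : X -> Z) (psi : Y -> Z)
    (F : Z -> \bar R) :
  measurable_fun setT phi -> measurable_fun setT psi ->
  (forall A, measurable A -> rho A = mu (phi @^-1` A) + nu (psi @^-1` A))%E ->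
  measurable_fun setT F ->
  mu.-integrable setT (F \o phi) -> nu.-integrable setT (F \o psi) ->
  (\int[rho]_z F z = \int[mu]_x F (phi x) + \int[nu]_y F (psi y))%E.
Proof.
move=> mphi mpsi rhoE mF iF1 iF2.
rewrite (eq_measure_integral
  (measure_add (pushforward mu phi) (pushforward nu psi))); last first.
  by move=> A mA _; rewrite rhoE//; apply: esym; exact: measure_addE.
rewrite (integral_measure_add measurableT
  (integrable_pushforward mphi mF iF1 measurableT)
  (integrable_pushforward mpsi mF iF2 measurableT)).
by rewrite (integral_pushforward mphi mF iF1 measurableT)
  (integral_pushforward mpsi mF iF2 measurableT).
Qed.

(** This version serves for the squared norm: integrability along the axes is deduced from the
    resulting formula and so cannot be presupposed. *)
Lemma ge0_integral_pushforward_add (R : realType) (d1 d2 d : measure_display)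
    (X : measurableType d1) (Y : measurableType d2) (Z : measurableType d)
    (mu : {measure set X -> \bar R}) (nu : {measure set Y -> \bar R})
    (rho : {measure set Z -> \bar R}) (phi : X -> Z) (psi : Y -> Z)
    (F : Z -> \bar R) :
  measurable_fun setT phi -> measurable_fun setT psi ->
  (forall A, measurable A -> rho A = mu (phi @^-1` A) + nu (psi @^-1` A))%E ->
  measurable_fun setT F -> (forall z, 0 <= F z)%E ->
  (\int[rho]_z F z = \int[mu]_x F (phi x) + \int[nu]_y F (psi y))%E.
Proof.
move=> mphi mpsi rhoE mF F0.
rewrite (eq_measure_integral
  (measure_add (pushforward mu phi) (pushforward nu psi))); last first.
  by move=> A mA _; rewrite rhoE//; apply: esym; exact: measure_addE.
have F0' : {in setT, forall y, (0 <= F y)%E} by [].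
rewrite (ge0_integral_measure_add _ _ measurableT (fun z _ => F0 z) mF).
by rewrite (@ge0_integral_pushforward _ _ _ _ _ _ mphi mu _ _ measurableT mF F0')
  (@ge0_integral_pushforward _ _ _ _ _ _ mpsi nu _ _ measurableT mF F0').
Qed.

(** * Fourier coefficients: integrability, real and imaginary parts *)

Lemma integrable_trig_comb (d : measure_display) (T : measurableType d)
    (R : realType) (mu : {finite_measure set T -> \bar R}) (u v c s : T -> R) :
  measurable_fun setT u -> measurable_fun setT v ->
  measurable_fun setT c -> measurable_fun setT s ->
  (forall x, `|c x| <= 1) -> (forall x, `|s x| <= 1) ->
  mu.-integrable setT (fun x => (u x ^+ 2 + v x ^+ 2)%:E) ->
  mu.-integrable setT (EFin \o (fun x => u x * c x + v x * s x)).
Proof.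
move=> measu measv mc ms c1 s1 iuv.
(* Domination by [u^2 + v^2 + 1], where the constant is integrable because [mu] is finite: [|u c + v
   s| <= |u| + |v| <= u^2 + v^2 + 1]. *)
apply: (@le_integrable _ _ _ mu _ measurableT _
  (fun x => ((u x ^+ 2 + v x ^+ 2)%:E + 1%:E)%E)).
- by apply/measurable_EFinP; apply: measurable_funD; apply: measurable_funM.
- move=> x _; rewrite -EFinD !abse_EFin lee_fin.
  rewrite [leRHS]ger0_norm; last by rewrite !addr_ge0// sqr_ge0.
  apply: (le_trans (ler_normD _ _)); rewrite !normrM.
  have uc := ler_pM (normr_ge0 (u x)) (normr_ge0 _) (lexx _) (c1 x).
  have vs := ler_pM (normr_ge0 (v x)) (normr_ge0 _) (lexx _) (s1 x).
  apply: (le_trans (lerD uc vs)); rewrite !mulr1.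
  rewrite -(real_normK (num_real (u x))) -(real_normK (num_real (v x))).
  (* Half the sum of this inequality and the next is [|u| + |v| <= u^2 + v^2 + 1]. *)
  have : 0 <= (`|u x| - 1) ^+ 2 + (`|v x| - 1) ^+ 2 by rewrite addr_ge0// sqr_ge0.
  have : 0 <= `|u x| ^+ 2 + `|v x| ^+ 2 by rewrite addr_ge0// sqr_ge0.
  by move: `|u x| `|v x| => a b; nra.
- apply: integrableD => //; exact: finite_measure_integrable_cst.
Qed.

(** The coefficient is split into real and imaginary parts because these are additive over the two
    axes, whereas the squared modulus is not. *)
Definition fourier_re (R : realType) (d : nat)
    (mu : {measure set (Rd R d) -> \bar R}) (u v : Rd R d -> R) (l : 'rV[R]_d) : R :=
  Rintegral mu setT (fun x => u x * cos (2 * pi * dotv l x)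
                              + v x * sin (2 * pi * dotv l x)).

Definition fourier_im (R : realType) (d : nat)
    (mu : {measure set (Rd R d) -> \bar R}) (u v : Rd R d -> R) (l : 'rV[R]_d) : R :=
  Rintegral mu setT (fun x => v x * cos (2 * pi * dotv l x)
                              - u x * sin (2 * pi * dotv l x)).

Lemma fourier_coef2E (R : realType) (d : nat)
    (mu : {measure set (Rd R d) -> \bar R}) (u v : Rd R d -> R) (l : 'rV[R]_d) :
  fourier_coef2 mu u v l = fourier_re _ _ mu u v l ^+ 2 + fourier_im _ _ mu u v l ^+ 2.
Proof. by []. Qed.

Lemma integrable_fourier_re (R : realType) (d : nat)
    (mu : {finite_measure set (Rd R d) -> \bar R}) (u v : Rd R d -> R) (l : 'rV[R]_d) :
  L2fun mu u v ->
  mu.-integrable setT (EFin \o (fun x => u x * cos (2 * pi * dotv l x)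
                              + v x * sin (2 * pi * dotv l x))).
Proof.
move=> [measu measv iuv].
apply: (integrable_trig_comb _ _ _ mu _ _ _ _ measu measv
  (measurable_cos_dotv _ _ _) (measurable_sin_dotv _ _ _)) => // x.
- by rewrite ler_norml cos_geN1 cos_le1.
- by rewrite ler_norml sin_geN1 sin_le1.
Qed.

(** The pair [(v, -u)] stands for [-i f], which has the same modulus as [f]. Facts about real parts
    thereby carry over to imaginary parts. *)
Lemma L2fun_rot (R : realType) (d : nat)
    (mu : {measure set (Rd R d) -> \bar R}) (u v : Rd R d -> R) :
  L2fun mu u v -> L2fun mu v (fun x => - u x).
Proof.
move=> [measu measv iuv]; split => //; first exact: measurableT_comp.
by under eq_fun do rewrite sqrrN addrC.
Qed.

(* Multiplying f by -i exchanges the two components. *)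
Lemma fourier_imE (R : realType) (d : nat)
    (mu : {measure set (Rd R d) -> \bar R}) (u v : Rd R d -> R) (l : 'rV[R]_d) :
  fourier_im _ _ mu u v l = fourier_re _ _ mu v (fun x => - u x) l.
Proof. by rewrite /fourier_re; under eq_fun do rewrite mulNr. Qed.

Lemma dotv_row_mx (R : realType) (n m : nat) (l x : 'rV[R]_n) (s y : 'rV[R]_m) :
  dotv (row_mx l s) (row_mx x y) = dotv l x + dotv s y.
Proof.
rewrite /dotv big_split_ord/=; congr (_ + _); apply: eq_bigr => i _.
  by rewrite !row_mxEl.
by rewrite !row_mxEr.
Qed.

Lemma dotv0 (R : realType) (n : nat) (l : 'rV[R]_n) : dotv l 0 = 0.
Proof. by rewrite /dotv big1// => i _; rewrite mxE mulr0. Qed.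

(** * Norm and coefficients of the measure on the two axes *)

Definition axis1 (R : realType) (n m : nat) (x : Rd R n) : Rd R (n + m) := row_mx x 0.
Definition axis2 (R : realType) (n m : nat) (y : Rd R m) : Rd R (n + m) := row_mx 0 y.

(** That is, [rho] is the sum of the pushforwards of [mu] and [nu] along the axes; it is convertible
    to the hypothesis of the theorem. *)
Definition axis_sum (R : realType) (n m : nat)
    (mu : {measure set (Rd R n) -> \bar R}) (nu : {measure set (Rd R m) -> \bar R})
    (rho : {measure set (Rd R (n + m)) -> \bar R}) : Prop :=
  forall A : set (Rd R (n + m)), measurable A ->
    rho A = (mu (axis1 R n m @^-1` A) + nu (axis2 R n m @^-1` A))%E.

Lemma L2norm2_axis_sum (R : realType) (n m : nat)
    (mu : {measure set (Rd R n) -> \bar R}) (nu : {measure set (Rd R m) -> \bar R})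
    (rho : {measure set (Rd R (n + m)) -> \bar R}) (u v : Rd R (n + m) -> R) :
  axis_sum _ _ _ mu nu rho -> measurable_fun setT u -> measurable_fun setT v ->
  (L2norm2 rho u v = L2norm2 mu (u \o axis1 R n m) (v \o axis1 R n m)
                     + L2norm2 nu (u \o axis2 R n m) (v \o axis2 R n m))%E.
Proof.
move=> rhoE measu measv.
apply: (ge0_integral_pushforward_add _ _ _ _ _ _ _ mu nu rho
  (axis1 R n m) (axis2 R n m)
  (fun z => (u z ^+ 2 + v z ^+ 2)%:E)
  (measurable_row_mx0r R n m) (measurable_row_mx0l R n m) rhoE).
  by apply/measurable_EFinP; apply: measurable_funD; exact: measurable_funX.
by move=> z; rewrite lee_fin addr_ge0// sqr_ge0.
Qed.

Lemma L2norm2_ge0 (R : realType) (d : nat)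
    (mu : {measure set (Rd R d) -> \bar R}) (u v : Rd R d -> R) :
  (0 <= L2norm2 mu u v)%E.
Proof. by apply: integral_ge0 => x _; rewrite lee_fin addr_ge0// sqr_ge0. Qed.

Lemma L2funE (R : realType) (d : nat)
    (mu : {measure set (Rd R d) -> \bar R}) (u v : Rd R d -> R) :
  measurable_fun setT u -> measurable_fun setT v ->
  L2fun mu u v <-> (L2norm2 mu u v < +oo)%E.
Proof.
move=> measu measv.
have eqn : (\int[mu]_x `|(u x ^+ 2 + v x ^+ 2)%:E| = L2norm2 mu u v)%E.
  by apply: eq_integral => x _; rewrite abse_EFin ger0_norm// addr_ge0// sqr_ge0.
split => [[_ _ /integrableP[_]]|fin]; first by rewrite eqn.
split => //; apply/integrableP; split; last by rewrite eqn.
by apply/measurable_EFinP; apply: measurable_funD; exact: measurable_funX.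
Qed.

(** The squared norm over [rho] is a sum of two nonnegative terms, so its finiteness bounds each of
    them. *)
Lemma L2fun_axis_sum (R : realType) (n m : nat)
    (mu : {measure set (Rd R n) -> \bar R}) (nu : {measure set (Rd R m) -> \bar R})
    (rho : {measure set (Rd R (n + m)) -> \bar R}) (u v : Rd R (n + m) -> R) :
  axis_sum _ _ _ mu nu rho -> L2fun rho u v ->
  L2fun mu (u \o axis1 R n m) (v \o axis1 R n m) /\
  L2fun nu (u \o axis2 R n m) (v \o axis2 R n m).
Proof.
move=> rhoE uvL2; have [measu measv _] := uvL2.
have mi1 := measurable_row_mx0r R n m.
have mi2 := measurable_row_mx0l R n m.
move/(L2funE _ _ _ _ _ measu measv) : uvL2.
rewrite (L2norm2_axis_sum _ _ _ _ _ _ _ _ rhoE measu measv) => fin.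
split; apply/L2funE.
- exact: (measurableT_comp measu mi1).
- exact: (measurableT_comp measv mi1).
- by apply: le_lt_trans fin; rewrite leeDl// L2norm2_ge0.
- exact: (measurableT_comp measu mi2).
- exact: (measurableT_comp measv mi2).
- by apply: le_lt_trans fin; rewrite leeDr// L2norm2_ge0.
Qed.

(** The exponential of frequency [(l, s)] restricts to [e_l] on the first axis and to [e_s] on the
    second. Since [mu] and [nu] are finite, both integrals are finite, which is what lets [fine]
    distribute over their sum. *)
Lemma fourier_re_axis_sum (R : realType) (n m : nat)
    (mu : {finite_measure set (Rd R n) -> \bar R})
    (nu : {finite_measure set (Rd R m) -> \bar R})
    (rho : {measure set (Rd R (n + m)) -> \bar R}) (u v : Rd R (n + m) -> R)
    (l : 'rV[R]_n) (s : 'rV[R]_m) :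
  axis_sum _ _ _ mu nu rho -> L2fun rho u v ->
  fourier_re _ _ rho u v (row_mx l s) =
  fourier_re _ _ mu (u \o axis1 R n m) (v \o axis1 R n m) l +
  fourier_re _ _ nu (u \o axis2 R n m) (v \o axis2 R n m) s.
Proof.
move=> rhoE uvL2; have [measu measv _] := uvL2.
have [L1 L2] := L2fun_axis_sum _ _ _ _ _ _ _ _ rhoE uvL2.
have i1 := integrable_fourier_re _ _ _ _ _ l L1.
have i2 := integrable_fourier_re _ _ _ _ _ s L2.
pose F z := u z * cos (2 * pi * dotv (row_mx l s) z)
            + v z * sin (2 * pi * dotv (row_mx l s) z).
have F1 x : F (axis1 R n m x) = u (axis1 R n m x) * cos (2 * pi * dotv l x)
            + v (axis1 R n m x) * sin (2 * pi * dotv l x).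
  by rewrite /F dotv_row_mx dotv0 addr0.
have F2 y : F (axis2 R n m y) = u (axis2 R n m y) * cos (2 * pi * dotv s y)
            + v (axis2 R n m y) * sin (2 * pi * dotv s y).
  by rewrite /F dotv_row_mx dotv0 add0r.
have FE : (\int[rho]_z (F z)%:E = \int[mu]_x (F (axis1 R n m x))%:E
             + \int[nu]_y (F (axis2 R n m y))%:E)%E.
  apply: (integral_pushforward_add _ _ _ _ _ _ _ mu nu rho
    (axis1 R n m) (axis2 R n m)
    (EFin \o F) (measurable_row_mx0r R n m) (measurable_row_mx0l R n m) rhoE).
  - by apply/measurable_EFinP; apply: measurable_funD;
      apply: measurable_funM => //;
      [exact: measurable_cos_dotv|exact: measurable_sin_dotv].
  - by move: i1; congr (integrable _ _ _); apply/funext => x /=; rewrite F1.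
  - by move: i2; congr (integrable _ _ _); apply/funext => x /=; rewrite F2.
rewrite /fourier_re /Rintegral FE.
rewrite (eq_integral _ _ (fun x _ => congr1 EFin (F1 x))).
rewrite (eq_integral _ _ (fun y _ => congr1 EFin (F2 y))).
rewrite fineD//; [exact: (integrable_fin_num _ i1)|exact: (integrable_fin_num _ i2)].
Qed.

Lemma fourier_im_axis_sum (R : realType) (n m : nat)
    (mu : {finite_measure set (Rd R n) -> \bar R})
    (nu : {finite_measure set (Rd R m) -> \bar R})
    (rho : {measure set (Rd R (n + m)) -> \bar R}) (u v : Rd R (n + m) -> R)
    (l : 'rV[R]_n) (s : 'rV[R]_m) :
  axis_sum _ _ _ mu nu rho -> L2fun rho u v ->
  fourier_im _ _ rho u v (row_mx l s) =
  fourier_im _ _ mu (u \o axis1 R n m) (v \o axis1 R n m) l +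
  fourier_im _ _ nu (u \o axis2 R n m) (v \o axis2 R n m) s.
Proof.
move=> rhoE /L2fun_rot L2; rewrite !fourier_imE.
exact: fourier_re_axis_sum rhoE L2.
Qed.

(** * Small sets of atomless measures, and infiniteness of their frames *)

Lemma small_ball (R : realType) (d : nat) (nu : {finite_measure set (Rd R d) -> \bar R})
    (x : 'rV[R]_d) (e : R) : nu [set x] = 0%E -> 0 < e ->
  exists2 r : R, 0 < r & (nu (ball x r) < e%:E)%E.
Proof.
move=> nux e0.
(* The balls of radius [1/(k+1)] decrease to [{x}]; as [nu] is finite, continuity from above makes
   their measures tend to that of [{x}], which is zero. *)
pose B k : set 'rV[R]_d := ball x k.+1%:R^-1.
have mB k : measurable (B k : set (Rd R d)).
  by apply: sub_sigma_algebra; exact: ball_open.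
have capB : \bigcap_k B k = [set x].
  apply/seteqP; split => [y By|_ -> k _]; last exact: ballxx.
  apply/eqP; rewrite eq_sym -subr_eq0 -normr_eq0 eq_le normr_ge0 andbT.
  apply/ler_addgt0Pr => r r0; rewrite add0r.
  have [k kr] := @ltr_add_invr R 0 r r0.
  have := By k I; rewrite /B -ball_normE /ball_/= => /ltW/le_trans; apply.
  by move: kr; rewrite add0r => /ltW.
have B0 : (nu (B 0%N) < +oo)%E by rewrite -ge0_fin_numE// fin_num_measure.
have mcap : measurable (\bigcap_k B k : set (Rd R d)).
  exact: bigcap_measurable.
have ndB : nonincreasing_seq (B : nat -> set (Rd R d)).
  move=> i j ij; apply/subsetPset; apply: le_ball.
  by rewrite lef_pV2 ?posrE// ler_nat ltnS.
have nbh : nbhs (nu (\bigcap_k B k : set (Rd R d))) [set y | (y < e%:E)%E].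
  by apply: open_ereal_lt'; rewrite capB (_ : nu _ = 0%E)// lte_fin.
have [k _ /(_ k (leqnn k)) Bk] := nonincreasing_cvg_mu B0 mB mcap ndB nbh.
by exists k.+1%:R^-1.
Qed.

(** Compactness covers each cube [[-k, k]^d] by finitely many null balls, and countably many cubes
    exhaust the space. *)
Lemma null_of_null_balls (R : realType) (d : nat)
    (nu : {measure set (Rd R d) -> \bar R}) :
  (forall x : 'rV[R]_d, exists2 r : R, 0 < r & nu (ball x r) = 0%E) ->
  nu setT = 0%E.
Proof.
move=> nullb.
pose r x := sval (cid2 (nullb x)).
have r0 x : 0 < r x by rewrite /r; case: cid2.
have nur x : nu (ball x (r x)) = 0%E by rewrite /r; case: cid2.
pose K (k : nat) : set 'rV[R]_d :=
  [set v | forall i, `[(- k%:R), k%:R]%classic (v ord0 i)].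
have cK k : compact (K k).
  apply: (@rV_compact R d (fun=> `[(- k%:R), k%:R]%classic)) => _.
  exact: segment_compact.
have nK k : nu.-negligible (K k : set (Rd R d)).
  move: (cK k); rewrite compact_cover => /(_ _ setT (fun x => ball x (r x))).
  case=> [x _|x _|D _].
  - exact: ball_open.
  - by exists x => //; exact: ballxx.
  - rewrite /cover bigcup_fset => KD; apply: (@negligibleS _ (Rd R d) R nu _ _ KD).
    elim/big_ind : _ => [|A B|x _].
    + exact: negligible_set0.
    + exact: negligibleU.
    + apply/negligibleP; last exact: nur.
      by apply: sub_sigma_algebra; exact: ball_open.
apply: measure_negligible => //.
apply: (@negligibleS _ (Rd R d) R nu _ _ _ (negligible_bigcup nK)) => v _.
(* The norm on row vectors is the maximum norm, so a bound [k] on it puts [v] in the cube [K k]. *)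
have [k vk] : exists k : nat, `|v| <= k%:R.
  exists (Num.bound `|v|); apply: ltW; apply: archi_boundP; exact: normr_ge0.
exists k => // i; rewrite /= in_itv/= -ler_norml.
apply: le_trans vk; rewrite [leRHS]/Num.Def.normr/= mx_normrE.
exact: (le_bigmax _ (fun ij => `|v ij.1 ij.2|) (ord0, i)).
Qed.

(** If every set of measure below [e] were null, each point would have a null ball around it, and
    [nu] would vanish. *)
Lemma exists_small_set (R : realType) (d : nat)
    (nu : {finite_measure set (Rd R d) -> \bar R}) (e : R) :
  atomless nu -> nu setT <> 0%E -> 0 < e ->
  exists E : set (Rd R d), [/\ measurable E, (0 < nu E)%E & (nu E < e%:E)%E].
Proof.
move=> nuat nuT e0; apply: contrapT => noE; apply/nuT/null_of_null_balls => x.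
have [r r0 nur] := small_ball _ _ nu x e (nuat x) e0.
exists r => //; apply/eqP; rewrite eq_le measure_ge0 andbT leNgt.
apply/negP => nu0; apply: noE; exists (ball x r); split => //.
by apply: sub_sigma_algebra; exact: ball_open.
Qed.

(** The bound on [|u| + |v|] is symmetric so as to cover both the indicator [(1_E, 0)] and its
    rotation [(0, -1_E)], which yields the imaginary part. *)
Lemma fourier_re_le_mass (R : realType) (d : nat)
    (nu : {finite_measure set (Rd R d) -> \bar R}) (u v : Rd R d -> R)
    (E : set (Rd R d)) (l : 'rV[R]_d) :
  measurable E -> L2fun nu u v -> (forall x, `|u x| + `|v x| <= \1_E x) ->
  `|fourier_re _ _ nu u v l| <= fine (nu E).
Proof.
move=> mE uvL2 uvE.
have iuv := integrable_fourier_re _ _ nu u v l uvL2.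
have iE : nu.-integrable setT (EFin \o \1_E).
  by apply: integrable_indic => //; rewrite -ge0_fin_numE// fin_num_measure.
have -> : fine (nu E) = Rintegral nu setT (\1_E).
  by rewrite /Rintegral integral_indic// setIT.
apply: (le_trans (le_normr_Rintegral measurableT iuv)).
apply: le_Rintegral => //.
  exact: (integrable_norm iuv).
move=> x _; apply: le_trans (uvE x); apply: (le_trans (ler_normD _ _)).
rewrite !normrM; apply: lerD; rewrite -[leRHS]mulr1 ler_wpM2l//.
  by rewrite ler_norml cos_geN1 cos_le1.
by rewrite ler_norml sin_geN1 sin_le1.
Qed.

(** For the indicator of [E] the squared norm is [nu E], while each squared coefficient is at most
    [2 (nu E)^2]. With [N] frequencies the lower frame bound gives [A (nu E) <= 2 N (nu E)^2], which
    fails when [nu E] is positive and small. *)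
Lemma fourier_frame_infinite (R : realType) (d : nat)
    (nu : {finite_measure set (Rd R d) -> \bar R}) (Lam : set 'rV[R]_d) :
  atomless nu -> nu setT <> 0%E -> fourier_frame nu Lam -> infinite_set Lam.
Proof.
move=> nuat nuT [_ [A [B [A0 B0 frame]]]] finL.
pose N : R := (size (finmap.enum_fset (fset_set Lam)))%:R.
have N0 : 0 <= N by rewrite /N.
(* The [+ 1] keeps the threshold meaningful when [Lam] is empty. *)
have [|E [mE E0 Ee]] := exists_small_set _ _ nu (A / (2 * N + 1)) nuat nuT.
  by rewrite divr_gt0// ltr_wpDl// mulr_ge0.
have finE : nu E \is a fin_num by rewrite fin_num_measure.
have m1E : measurable_fun setT (\1_E : Rd R d -> R) by exact: measurable_indic.
have norm : L2norm2 nu \1_E (cst 0) = nu E.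
  transitivity (\int[nu]_x (\1_E x)%:E)%E; last by rewrite integral_indic// setIT.
  apply: eq_integral => x _; congr EFin.
  by rewrite indicE; case: (_ \in _); rewrite /= ?expr1n ?expr0n/= ?addr0.
have uvL2 : L2fun nu \1_E (cst 0).
  by apply/L2funE => //; rewrite norm -ge0_fin_numE.
have [low _] := frame _ _ uvL2.
have coef l : fourier_coef2 nu \1_E (cst 0) l <= 2 * fine (nu E) ^+ 2.
  rewrite fourier_coef2E fourier_imE.
  have sq (a b : R) : `|a| <= b -> a ^+ 2 <= b ^+ 2.
    by move=> ab; rewrite -(real_normK (num_real a)) lerXn2r ?nnegrE// (le_trans _ ab).
  have nE (x : Rd R d) : 0 <= \1_E x :> R by rewrite indicE.
  rewrite mulr2n mulrDl mul1r; apply: lerD; apply: sq.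
    apply: fourier_re_le_mass => // x; rewrite normr0 addr0 ger0_norm//.
  apply: fourier_re_le_mass => //; first exact: L2fun_rot.
  by move=> x; rewrite normr0 add0r normrN ger0_norm.
have up : (\esum_(l in Lam) (fourier_coef2 nu \1_E (cst 0) l)%:E
          <= (N * (2 * fine (nu E) ^+ 2))%:E)%E.
  apply: (@le_trans _ _ (\esum_(l in Lam) (2 * fine (nu E) ^+ 2)%:E)).
    by apply: le_esum => l _; rewrite lee_fin; exact: coef.
  rewrite esum_fset//; last by move=> *; rewrite lee_fin mulr_ge0// sqr_ge0.
  rewrite fsbig_finite//= sumEFin lee_fin big_const_seq count_predT.
  by rewrite iter_addr_0 -[leLHS]mulr_natl.
have := le_trans low up; rewrite norm -(fineK finE) -EFinM lee_fin.
move: E0 Ee; rewrite -(fineK finE) !lte_fin /= ltr_pdivlMr; last first.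
  by rewrite ltr_wpDl// mulr_ge0.
move: (fine (nu E)) => x x0 xA; nra.
Qed.

(** * Comparison of sums over pairs with sums over the two frames *)

Lemma paired_esum_bounds (R : realType) (T1 T2 T : choiceType) (S : set (T1 * T2))
    (j : T1 * T2 -> T) (A : set T1) (B : set T2) (N : nat)
    (a : T1 -> R) (b : T2 -> R) (c : T -> R) :
  injective j ->
  (forall a : T1 -> \bar R, (forall x, 0 <= a x)%E ->
    \esum_(p in S) a p.1 = (N%:R%:E * \esum_(x in A) a x)%E) ->
  (forall b : T2 -> \bar R, (forall y, 0 <= b y)%E ->
    (\esum_(p in S) b p.2 <= \esum_(y in B) b y)%E) ->
  (forall x, 0 <= a x) -> (forall y, 0 <= b y) -> (forall z, 0 <= c z) ->
  (forall p, c (j p) <= 2 * a p.1 + 2 * b p.2) ->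
  (forall p, a p.1 <= 2 * c (j p) + 2 * b p.2) ->
  (\esum_(z in j @` S) (c z)%:E
     <= 2%:E * (N%:R%:E * (\esum_(x in A) (a x)%:E))
        + 2%:E * (\esum_(y in B) (b y)%:E))%E
  /\ (N%:R%:E * (\esum_(x in A) (a x)%:E)
     <= 2%:E * (\esum_(z in j @` S) (c z)%:E)
        + 2%:E * (\esum_(y in B) (b y)%:E))%E.
Proof.
move=> jinj SA SB a0 b0 c0 cab acb.
(* All terms are nonnegative, so the sums split even when they are infinite. The map [j] stays
   abstract because the lemma is applied with both orders of the coordinates. *)
have esum2 (f g : T1 * T2 -> R) : (forall p, 0 <= f p) -> (forall p, 0 <= g p) ->
    (\esum_(p in S) (2 * f p + 2 * g p)%:E =
     2%:E * (\esum_(p in S) (f p)%:E) + 2%:E * (\esum_(p in S) (g p)%:E))%E.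
  move=> f0 g0; rewrite !mule_natl !mule2n -!esumD//;
    do ?[by move=> *; rewrite ?adde_ge0 ?lee_fin].
  by apply: eq_esum => p _; rewrite -!EFinD; congr EFin; ring.
rewrite esum_image; last by move=> p q _ _ /jinj.
rewrite -SA//; split.
- apply: (@le_trans _ _ (\esum_(p in S) (2 * a p.1 + 2 * b p.2)%:E)).
    by apply: le_esum => p _; rewrite lee_fin.
  by rewrite esum2// leeD2l// lee_pmul2l// SB// => y; rewrite lee_fin.
- apply: (@le_trans _ _ (\esum_(p in S) (2 * c (j p) + 2 * b p.2)%:E)).
    by apply: le_esum => p _; rewrite lee_fin.
  by rewrite esum2// leeD2l// lee_pmul2l// SB// => y; rewrite lee_fin.
Qed.

(** * Transport of frames, and the case where one measure is zero *)

Lemma null_integral (R : realType) (d : measure_display) (T : measurableType d)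
    (mu : {measure set T -> \bar R}) (f : T -> \bar R) :
  mu setT = 0%E -> (\int[mu]_x f x = 0)%E.
Proof.
move=> mu0; rewrite (eq_measure_integral mzero) ?integral_measure_zero//.
move=> A mA _; apply/eqP; rewrite eq_le measure_ge0 andbT.
by apply: (@le_trans _ _ (mu setT)); [rewrite le_measure ?inE|rewrite mu0].
Qed.

Lemma null_Rintegral (R : realType) (d : measure_display) (T : measurableType d)
    (mu : {measure set T -> \bar R}) (f : T -> R) :
  mu setT = 0%E -> Rintegral mu setT f = 0.
Proof. by move=> mu0; rewrite /Rintegral null_integral. Qed.

(** Here [i] moves points and [j] moves frequencies; the frame constants are unchanged. It is
    applied when only one axis carries mass. *)
Lemma fourier_frame_image (R : realType) (n m : nat)
    (mu : {measure set (Rd R n) -> \bar R}) (rho : {measure set (Rd R m) -> \bar R})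
    (i : Rd R n -> Rd R m) (j : 'rV[R]_n -> 'rV[R]_m) (Lam : set 'rV[R]_n) :
  injective j ->
  (forall u v, L2fun rho u v ->
    [/\ L2fun mu (u \o i) (v \o i),
        L2norm2 rho u v = L2norm2 mu (u \o i) (v \o i) &
        forall l, fourier_coef2 rho u v (j l) = fourier_coef2 mu (u \o i) (v \o i) l]) ->
  fourier_frame mu Lam -> fourier_frame rho (j @` Lam).
Proof.
move=> jinj tr [cL [A [B [A0 B0 frame]]]]; split.
  exact: (sub_countable (card_image_le _ _) cL).
exists A, B; split => // u v /tr[L2 -> coef].
rewrite esum_image; last by move=> p q _ _ /jinj.
by rewrite (eq_esum (fun l _ => congr1 EFin (coef l))); exact: frame.
Qed.

Lemma paired_squares (R : realFieldType) (p q p' q' : R) :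
  [/\ (p + p') ^+ 2 + (q + q') ^+ 2 <= 2 * (p ^+ 2 + q ^+ 2) + 2 * (p' ^+ 2 + q' ^+ 2),
      p ^+ 2 + q ^+ 2 <= 2 * ((p + p') ^+ 2 + (q + q') ^+ 2) + 2 * (p' ^+ 2 + q' ^+ 2) &
      p' ^+ 2 + q' ^+ 2 <= 2 * ((p + p') ^+ 2 + (q + q') ^+ 2) + 2 * (p ^+ 2 + q ^+ 2)].
Proof.
(* In each of the three inequalities the right side minus the left is a sum of two of these squares,
   for example [(p + 2 p')^2 + (q + 2 q')^2] in the second. *)
have h1 := sqr_ge0 (p - p'); have h2 := sqr_ge0 (q - q').
have h3 := sqr_ge0 (p + 2 * p'); have h4 := sqr_ge0 (q + 2 * q').
have h5 := sqr_ge0 (2 * p + p'); have h6 := sqr_ge0 (2 * q + q').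
by split; nra.
Qed.

Lemma fourier_coef2_ge0 (R : realType) (d : nat)
    (mu : {measure set (Rd R d) -> \bar R}) (u v : Rd R d -> R) (l : 'rV[R]_d) :
  0 <= fourier_coef2 mu u v l.
Proof. by rewrite addr_ge0// sqr_ge0. Qed.

Lemma fourier_coef2_axis_sum (R : realType) (n m : nat)
    (mu : {finite_measure set (Rd R n) -> \bar R})
    (nu : {finite_measure set (Rd R m) -> \bar R})
    (rho : {measure set (Rd R (n + m)) -> \bar R}) (u v : Rd R (n + m) -> R)
    (l : 'rV[R]_n) (s : 'rV[R]_m) :
  axis_sum _ _ _ mu nu rho -> L2fun rho u v ->
  fourier_coef2 rho u v (row_mx l s) =
    (fourier_re _ _ mu (u \o axis1 R n m) (v \o axis1 R n m) l +
     fourier_re _ _ nu (u \o axis2 R n m) (v \o axis2 R n m) s) ^+ 2 +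
    (fourier_im _ _ mu (u \o axis1 R n m) (v \o axis1 R n m) l +
     fourier_im _ _ nu (u \o axis2 R n m) (v \o axis2 R n m) s) ^+ 2.
Proof.
move=> rhoE uvL2; rewrite fourier_coef2E.
by rewrite (fourier_re_axis_sum _ _ _ _ _ _ _ _ l s rhoE uvL2)
  (fourier_im_axis_sum _ _ _ _ _ _ _ _ l s rhoE uvL2).
Qed.

Lemma frame_of_null_r (R : realType) (n m : nat)
    (mu : {finite_measure set (Rd R n) -> \bar R})
    (nu : {finite_measure set (Rd R m) -> \bar R})
    (rho : {measure set (Rd R (n + m)) -> \bar R}) (Lam : set 'rV[R]_n) :
  axis_sum _ _ _ mu nu rho -> nu setT = 0%E -> fourier_frame mu Lam ->
  fourier_frame rho ((fun l => row_mx l 0) @` Lam).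
Proof.
move=> rhoE nu0.
apply: (fourier_frame_image _ _ _ mu rho (axis1 R n m)) => [l l'|u v uvL2].
  by case/eq_row_mx.
have [L1 L2] := L2fun_axis_sum _ _ _ _ _ _ _ _ rhoE uvL2.
have [measu measv _] := uvL2; split => // [|l].
  rewrite (L2norm2_axis_sum _ _ _ _ _ _ _ _ rhoE measu measv).
  rewrite [X in (_ + X)%E](_ : _ = 0%E) ?adde0//.
  exact: null_integral.
rewrite (fourier_coef2_axis_sum _ _ _ _ _ _ _ _ l 0 rhoE uvL2) fourier_coef2E.
by rewrite /fourier_re /fourier_im !(null_Rintegral _ _ _ nu)// !addr0.
Qed.

Lemma frame_of_null_l (R : realType) (n m : nat)
    (mu : {finite_measure set (Rd R n) -> \bar R})
    (nu : {finite_measure set (Rd R m) -> \bar R})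
    (rho : {measure set (Rd R (n + m)) -> \bar R}) (Lam : set 'rV[R]_m) :
  axis_sum _ _ _ mu nu rho -> mu setT = 0%E -> fourier_frame nu Lam ->
  fourier_frame rho ((fun s => row_mx 0 s) @` Lam).
Proof.
move=> rhoE mu0.
apply: (fourier_frame_image _ _ _ nu rho (axis2 R n m)) => [l l'|u v uvL2].
  by case/eq_row_mx.
have [L1 L2] := L2fun_axis_sum _ _ _ _ _ _ _ _ rhoE uvL2.
have [measu measv _] := uvL2; split => // [|l].
  rewrite (L2norm2_axis_sum _ _ _ _ _ _ _ _ rhoE measu measv).
  rewrite [X in (X + _)%E](_ : _ = 0%E) ?add0e//.
  exact: null_integral.
rewrite (fourier_coef2_axis_sum _ _ _ _ _ _ _ _ 0 l rhoE uvL2) fourier_coef2E.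
by rewrite /fourier_re /fourier_im !(null_Rintegral _ _ _ mu)// !add0r.
Qed.

(** * The union of two families of pairs when both frames are infinite *)

Lemma frame_of_infinite (R : realType) (n m : nat)
    (mu : {finite_measure set (Rd R n) -> \bar R})
    (nu : {finite_measure set (Rd R m) -> \bar R})
    (rho : {measure set (Rd R (n + m)) -> \bar R})
    (L : set 'rV[R]_n) (M : set 'rV[R]_m) :
  axis_sum _ _ _ mu nu rho -> infinite_set L -> infinite_set M ->
  fourier_frame mu L -> fourier_frame nu M -> admits_fourier_frame rho.
Proof.
move=> rhoE infL infM [cL [A1 [B1 [A1_0 B1_0 frame1]]]]
  [cM [A2 [B2 [A2_0 B2_0 frame2]]]].
(* [N] is chosen so that [N A1 >= 2 B1 + 4] and [N A2 >= 2 B2 + 4]. The terms [2 B1], [2 B2] absorb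
   the cross terms; the [4] matches the factor [4] in front of the sum over the union, which makes
   the lower frame constant [1]. *)
pose N := (Num.bound ((2 * B1 + 4) / A1) + Num.bound ((2 * B2 + 4) / A2))%N.
have NA (A B : R) (k : nat) : 0 < A -> 0 < B ->
    (Num.bound ((2 * B + 4) / A) <= k)%N ->
    2 * B + 4 <= k%:R * A.
  move=> A0 B0 kb; rewrite -ler_pdivrMr//; apply: ltW.
  apply: (lt_le_trans (archi_boundP _)); last by rewrite ler_nat.
  by rewrite divr_ge0 ?addr_ge0 ?mulr_ge0// ltW.
have NA1 : 2 * B1 + 4 <= N%:R * A1 by apply: NA => //; exact: leq_addr.
have NA2 : 2 * B2 + 4 <= N%:R * A2 by apply: NA => //; exact: leq_addl.
have [S [cS S1 S2]] := exists_pairing _ _ _ _ N cL infM.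
have [S' [cS' S1' S2']] := exists_pairing _ _ _ _ N cM infL.
pose j (p : 'rV[R]_n * 'rV[R]_m) : 'rV[R]_(n + m) := row_mx p.1 p.2.
pose j' (p : 'rV[R]_m * 'rV[R]_n) : 'rV[R]_(n + m) := row_mx p.2 p.1.
have jinj : injective j by move=> [l s] [l' s'] /eq_row_mx[/= -> ->].
have jinj' : injective j' by move=> [s l] [s' l'] /eq_row_mx[/= -> ->].
exists (j @` S `|` j' @` S'); split.
  rewrite -bigcup2E; apply: bigcup_countable => // -[|[|k]] _ //=.
    exact: (sub_countable (card_image_le _ _) cS).
  exact: (sub_countable (card_image_le _ _) cS').
exists 1, (2 * (N%:R + 1) * (B1 + B2)); split => //.
  by rewrite !mulr_gt0 ?addr_gt0 ?ltr_wpDl.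
move=> u v uvL2.
have [L1 L2] := L2fun_axis_sum _ _ _ _ _ _ _ _ rhoE uvL2.
have [measu measv _] := uvL2.
have [low1 up1] := frame1 _ _ L1; have [low2 up2] := frame2 _ _ L2.
rewrite (L2norm2_axis_sum _ _ _ _ _ _ _ _ rhoE measu measv).
set a := fourier_coef2 mu _ _ in low1 up1.
set b := fourier_coef2 nu _ _ in low2 up2.
set c := fourier_coef2 rho _ _.
have a0 l : 0 <= a l by exact: fourier_coef2_ge0.
have b0 l : 0 <= b l by exact: fourier_coef2_ge0.
have c0 l : 0 <= c l by exact: fourier_coef2_ge0.
have abc l s : [/\ c (row_mx l s) <= 2 * a l + 2 * b s,
    a l <= 2 * c (row_mx l s) + 2 * b s & b s <= 2 * c (row_mx l s) + 2 * a l].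
  rewrite /a /b /c (fourier_coef2_axis_sum _ _ _ _ _ _ _ _ l s rhoE uvL2).
  exact: paired_squares.
have [p|p|upS lowS] := paired_esum_bounds _ _ _ _ S j L M N a b c
  jinj (S1 R) (S2 R) a0 b0 c0.
- by have [] := abc p.1 p.2.
- by have [] := abc p.1 p.2.
have [p|p|upS' lowS'] := paired_esum_bounds _ _ _ _ S' j' M L N b a c
  jinj' (S1' R) (S2' R) b0 a0 c0.
- by have [+ _ _] := abc p.2 p.1; rewrite addrC.
- by have [] := abc p.2 p.1.
have finX : L2norm2 mu (u \o axis1 R n m) (v \o axis1 R n m) \is a fin_num.
  rewrite ge0_fin_numE ?L2norm2_ge0//; have [p q _] := L1.
  exact/L2funE.
have finY : L2norm2 nu (u \o axis2 R n m) (v \o axis2 R n m) \is a fin_num.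
  rewrite ge0_fin_numE ?L2norm2_ge0//; have [p q _] := L2.
  exact/L2funE.
have X0 := L2norm2_ge0 _ _ mu (u \o axis1 R n m) (v \o axis1 R n m).
have Y0 := L2norm2_ge0 _ _ nu (u \o axis2 R n m) (v \o axis2 R n m).
move: finX finY X0 Y0 low1 up1 low2 up2.
move: (L2norm2 mu _ _) (L2norm2 nu _ _) => X Y /fineK <- /fineK <-.
move: (fine X) (fine Y) => {X Y} x y; rewrite !lee_fin => x0 y0.
(* The upper bounds make every sum finite, so the inequalities can be moved from the extended reals
   to the reals for linear arithmetic. *)
have fin (T : choiceType) (D : set T) (f : T -> R) (r : R) : (forall z, 0 <= f z) ->
    (\esum_(z in D) (f z)%:E <= r%:E)%E ->
    \esum_(z in D) (f z)%:E \is a fin_num.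
  move=> f0 fr; rewrite ge0_fin_numE; first by rewrite (le_lt_trans fr)// ltry.
  by apply: esum_ge0 => z _; rewrite lee_fin.
have c0' z : (0 <= (c z)%:E)%E by rewrite lee_fin.
(* The two families may overlap: the sum over the union is bounded below by each sum separately and
   above by their total. *)
have subS := subset_esum _ _ (j @` S) (j @` S `|` j' @` S') _ c0' (@subsetUl _ _ _).
have subS' := subset_esum _ _ (j' @` S') (j @` S `|` j' @` S') _ c0' (@subsetUr _ _ _).
have SU := esum_setU_le _ _ (j @` S) (j' @` S') _ c0'.
move=> low1 up1 low2 up2.
have fa := fin _ _ _ _ a0 up1; have fb := fin _ _ _ _ b0 up2.
move: low1 up1 low2 up2 upS lowS upS' lowS'.
rewrite -(fineK fa) -(fineK fb).
move: (fine _) (fine _) => sa sb.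
rewrite -!EFinM -!EFinD !lee_fin => low1 up1 low2 up2 upS lowS upS' lowS'.
have fS := fin _ _ _ _ c0 upS; have fS' := fin _ _ _ _ c0 upS'.
have fU : \esum_(z in j @` S `|` j' @` S') (c z)%:E \is a fin_num.
  by apply: (fin _ _ _ _ c0 (le_trans SU _)); rewrite -(fineK fS) -(fineK fS') -EFinD.
move: upS lowS upS' lowS' subS subS' SU.
rewrite -(fineK fS) -(fineK fS') -(fineK fU).
move: (fine _) (fine _) (fine _) => sS sS' sU.
rewrite -?EFinM -?EFinD !lee_fin => upS lowS upS' lowS' subS subS' SU.
have N0 : 0 <= N%:R :> R by [].
split.
  (* Adding [lowS] and [lowS'] gives [N (sa + sb) <= 4 sU + 2 (sa + sb)]. The frame bounds on [sa]
     and [sb] and the choice of [N] then leave [4 (x + y) <= 4 sU]. *)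
  have h1 := ler_wpM2l N0 low1; have h2 := ler_wpM2l N0 low2.
  have h3 := ler_wpM2r x0 NA1; have h4 := ler_wpM2r y0 NA2.
  rewrite mul1r; lra.
(* Adding [upS] and [upS'] gives [sU <= 2 (N + 1) (sa + sb)], and the Bessel bounds apply to [sa]
   and [sb]. *)
apply: (@le_trans _ _ (2 * (N%:R + 1) * (B1 * x + B2 * y))).
  have h1 := ler_wpM2l N0 up1; have h2 := ler_wpM2l N0 up2.
  lra.
rewrite -[leRHS]mulrA ler_wpM2l ?mulr_ge0 ?addr_ge0//.
have h1 := mulr_ge0 (ltW B1_0) y0; have h2 := mulr_ge0 (ltW B2_0) x0.
lra.
Qed.

Theorem theorem2p1 (R : realType) (n m : nat)
  (mu : {finite_measure set (Rd R n) -> \bar R})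
  (nu : {finite_measure set (Rd R m) -> \bar R})
  (rho : {measure set (Rd R (n + m)) -> \bar R}) :
  atomless mu -> atomless nu ->
  admits_fourier_frame mu -> admits_fourier_frame nu ->
  (* rho = mu x delta_0 + delta_0 x nu on R^(n+m) = R^n x R^m *)
  (forall A : set (Rd R (n + m)), measurable A ->
     rho A = (mu [set x : Rd R n | A (row_mx x 0 : 'rV[R]_(n + m))]
              + nu [set y : Rd R m | A (row_mx 0 y : 'rV[R]_(n + m))])%E) ->
  admits_fourier_frame rho.
Proof.
move=> muat nuat [L frL] [M frM] rhoE.
(* Only nonzero atomless measures force their frames to be infinite, so the null cases are split off
   first. *)
have [nu0|nu0] := pselect (nu setT = 0%E).
  by eexists; exact: frame_of_null_r rhoE nu0 frL.
have [mu0|mu0] := pselect (mu setT = 0%E).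
  by eexists; exact: frame_of_null_l rhoE mu0 frM.
apply: (frame_of_infinite _ _ _ mu nu rho L M) => //.
- exact: (fourier_frame_infinite _ _ mu).
- exact: (fourier_frame_infinite _ _ nu).
Qed.
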